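(* For every $q\in(0,1)$, rooted ternary trees do not admit empty-ply drawings constructed in orthogonal fashion with shrink factor $q$; that is, for every $q\in(0,1)$ there is a number of levels $k$ such that no orthogonal drawing with shrink factor $q$ of the complete rooted ternary tree with $k$ levels is empty-ply.
   Context: The complete rooted ternary tree with $k$ levels is the rooted tree in which every vertex at distance less than $k$ from the root has exactly $3$ children and every vertex at distance $k$ from the root is a leaf. An orthogonal drawing with shrink factor $q$ of such a tree is a straight-line drawing in which every edge is horizontal or vertical, the children of every non-root vertex $v$ are placed in the three axis-parallel directions from $v$ other than the direction towards the parent of $v$, and the distance from a vertex to each of its children is $q$ times its distance to its parent. For each vertex $v$, the ply-disk $D_v$ is the open disk centered at $v$ with radius equal to half the length of the longest edge incident to $v$. A drawing is empty-ply if every ply-disk $D_v$ contains no vertex other than $v$ in its interior. *)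

(* Defs.v *)
From mathcomp Require Import all_boot all_order all_algebra.
From mathcomp Require Import reals.

Set Implicit Arguments.
Unset Strict Implicit.
Unset Printing Implicit Defensive.

Import Order.TTheory GRing.Theory Num.Theory.
Local Open Scope ring_scope.

(* A vertex is encoded by the path of child indices leading to it from the
   root, so its distance from the root is the size of the sequence, the root is
   the empty sequence, and the leaves are the sequences of size k. *)
Notation ternary_vertex k := (k.-bseq 'I_3).

Definition is_child (k : nat) (v c : ternary_vertex k) : bool :=
  [exists i : 'I_3, (c : seq 'I_3) == rcons v i].

Definition adjacent (k : nat) (u v : ternary_vertex k) : bool :=
  is_child u v || is_child v u.

Definition edist (R : realType) (a b : R * R) : R :=
  Num.sqrt ((a.1 - b.1) ^+ 2 + (a.2 - b.2) ^+ 2).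

Inductive direction : Type := East | North | West | South.

Definition dir_vec (R : realType) (d : direction) : R * R :=
  match d with
  | East => (1, 0)
  | North => (0, 1)
  | West => (-1, 0)
  | South => (0, -1)
  end.

(* b lies in direction d from a: b is on the open ray from a along d. *)
Definition in_direction (R : realType) (d : direction) (a b : R * R) : Prop :=
  exists2 t : R, 0 < t &
    b = (a.1 + t * (dir_vec R d).1, a.2 + t * (dir_vec R d).2).

Section Drawings.
Variables (R : realType) (k : nat).

(* A straight-line drawing is determined by its vertex positions; only
   degenerate (zero-length) edges are excluded, crossings and overlaps are
   not. *)
Implicit Type pos : ternary_vertex k -> R * R.

Record orthogonal_drawing (q : R) pos : Prop := OrthogonalDrawing {
  od_nondegenerate : forall u v, adjacent u v -> pos u <> pos v;
  od_axis_parallel : forall u v, adjacent u v ->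
    (pos u).1 = (pos v).1 \/ (pos u).2 = (pos v).2;
  (* For p the parent of v, the set of directions from v to its children is
     the set of all directions except the one from v to p. *)
  od_directions : forall p v, is_child p v -> (size v < k)%N ->
    forall d : direction,
      (exists2 c, is_child v c & in_direction d (pos v) (pos c)) <->
      ~ in_direction d (pos v) (pos p);
  od_shrink : forall p v c, is_child p v -> is_child v c ->
    edist (pos v) (pos c) = q * edist (pos v) (pos p)
}.

(* Distances are nonnegative, so starting the maximum at 0 is harmless when v
   has an incident edge. *)
Definition ply_radius pos (v : ternary_vertex k) : R :=
  (\big[Num.max/0]_(u : ternary_vertex k | adjacent v u)
     edist (pos v) (pos u)) / 2.

Definition in_ply_disk pos (v : ternary_vertex k) (x : R * R) : Prop :=
  edist (pos v) x < ply_radius pos v.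

Definition empty_ply pos : Prop :=
  forall v u : ternary_vertex k, u <> v -> ~ in_ply_disk pos v (pos u).

End Drawings.

(* Main.v *)
Require Import Defs.
From mathcomp Require Import all_boot all_order all_algebra.
From mathcomp Require Import reals.
From mathcomp Require Import zify ring lra.

Set Implicit Arguments.
Unset Strict Implicit.
Unset Printing Implicit Defensive.

Import Order.TTheory GRing.Theory Num.Theory.
Local Open Scope ring_scope.

(** Let [v] be a child of the root whose parent edge has length [l], so that its
    disk has radius at least [l / 2], and let [a], [b] be perpendicular
    directions not leading to its parent.
    - If [q < 1/2], the children of [v] lie in the disk of [v].
    - If [1/2 <= q <= 3/4], so does the descendant reached from [v] along
      [a, b, -a, -a, -b]: its offset in the basis [(a, b)] is
      [l (q - q^3 - q^4, q^2 - q^5)], and both coordinates lie in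
      [[0, 7 l / 20]].
    - If [q > 3/4], the grandchildren reached along [a, b] and [b, a] are at
      distance [sqrt 2 l (q - q^2)], less than the radius [l q^2 / 2] of their
      disks. *)

(** * Axis-parallel displacements in the plane *)

Definition opposite (d : direction) : direction :=
  match d with
  | East => West
  | North => South
  | West => East
  | South => North
  end.

Definition perpendicular (a b : direction) : Prop := a <> b /\ a <> opposite b.

Definition shift (R : realType) (x : R * R) (t : R) (d : direction) : R * R :=
  (x.1 + t * (dir_vec R d).1, x.2 + t * (dir_vec R d).2).

(** Take for [b] the opposite of [e] and for [a] a direction perpendicular to [e]. *)
Lemma perpendicular_avoiding (e : direction) :
  exists a b, [/\ perpendicular a b, a <> e & b <> e].
Proof.
by case: e; [exists North, West | exists East, South | exists North, East
            | exists East, North]; split => //; split.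
Qed.

Lemma shift_opposite (R : realType) (x : R * R) (t : R) (d : direction) :
  shift (shift x t d) t (opposite d) = x.
Proof. by case: x => x y; case: d; rewrite /shift /=; congr pair; ring. Qed.

Lemma shiftN (R : realType) (x : R * R) (t : R) (d : direction) :
  shift x t (opposite d) = shift x (- t) d.
Proof. by case: d; rewrite /shift /=; congr pair; ring. Qed.

(** Pythagoras; [s] and [t] may have either sign, so backward steps are covered. *)
Lemma sqr_offset_perpendicular (R : realType) (x : R * R) (s t : R)
    (a b : direction) :
  perpendicular a b -> let y := shift (shift x s a) t b in
  (x.1 - y.1) ^+ 2 + (x.2 - y.2) ^+ 2 = s ^+ 2 + t ^+ 2.
Proof. by case; case: a; case: b => //= _ _; ring. Qed.

Lemma shift_inj_dir (R : realType) (x : R * R) (s t : R) (d e : direction) :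
  0 < s -> 0 < t -> shift x s d = shift x t e -> d = e.
Proof.
by move=> s0 t0; case: d; case: e => //; rewrite /shift /= => -[h1 h2]; exfalso; lra.
Qed.

Lemma edist_shift (R : realType) (x : R * R) (t : R) (d : direction) :
  0 <= t -> edist x (shift x t d) = t.
Proof.
move=> t0; rewrite /edist -[RHS](ger0_norm t0) -sqrtr_sqr; congr Num.sqrt.
by case: d; rewrite /shift /=; ring.
Qed.

Lemma edist_lt (R : realType) (x y : R * R) (r : R) : 0 < r ->
  (x.1 - y.1) ^+ 2 + (x.2 - y.2) ^+ 2 < r ^+ 2 -> edist x y < r.
Proof.
by move=> r0 h; rewrite -[r]ger0_norm ?ltW // -sqrtr_sqr ltr_sqrt ?exprn_gt0.
Qed.

Lemma is_child_size (k : nat) (v c : ternary_vertex k) :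
  is_child v c -> size c = (size v).+1.
Proof. by case/existsP => i /eqP ->; rewrite size_rcons. Qed.

Lemma is_child_inj (k : nat) (u v c : ternary_vertex k) :
  is_child u c -> is_child v c -> u = v.
Proof.
case/existsP => i /eqP cE /existsP [j]; rewrite cE => /eqP/rcons_inj [uv _].
exact: val_inj.
Qed.

(** * Edges and ply-disks of an orthogonal drawing *)

Section OrthogonalDrawing.
Variables (R : realType) (k : nat) (q : R) (pos : ternary_vertex k -> R * R).
Hypotheses (q_gt0 : 0 < q) (pos_ortho : orthogonal_drawing q pos).

(** The direction is oriented from the child to the parent: it is the one in which no child of [v]
    may lie. *)
Definition parent_edge (p v : ternary_vertex k) (l : R) (d : direction) : Prop :=
  [/\ is_child p v, 0 < l & pos p = shift (pos v) l d].

Lemma exists_parent_edge (p v : ternary_vertex k) :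
  is_child p v -> exists l d, parent_edge p v l d.
Proof.
move=> pv; have adj : adjacent p v by rewrite /adjacent pv.
have := od_nondegenerate pos_ortho adj; have := od_axis_parallel pos_ortho adj.
rewrite /parent_edge; case: (pos p) (pos v) => [x y] [x' y'] /= ax ne.
case: ax => e.
- subst x'; have /lt_total/orP[lt|lt] : y != y' by apply/eqP => e; rewrite e in ne.
  + exists (y' - y), South; split; rewrite ?subr_gt0 //.
    by rewrite /shift /=; congr pair; ring.
  + exists (y - y'), North; split; rewrite ?subr_gt0 //.
    by rewrite /shift /=; congr pair; ring.
- subst y'; have /lt_total/orP[lt|lt] : x != x' by apply/eqP => e; rewrite e in ne.
  + exists (x' - x), West; split; rewrite ?subr_gt0 //.
    by rewrite /shift /=; congr pair; ring.
  + exists (x - x'), East; split; rewrite ?subr_gt0 //.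
    by rewrite /shift /=; congr pair; ring.
Qed.

(** The parent lies in direction [e] only, so [od_directions] supplies a child in direction [d]. The
    result is again a [parent_edge], so the lemma can be iterated along a path. *)
Lemma child_in_direction (p v : ternary_vertex k) (l : R) (e d : direction) :
  parent_edge p v l e -> (size v < k)%N -> d <> e ->
  exists2 c, pos c = shift (pos v) (q * l) d &
             parent_edge v c (q * l) (opposite d).
Proof.
case=> pv l0 pos_p vk de.
have [|c vc [t t0 pos_c]] := (od_directions pos_ortho pv vk d).2.
  by case=> t t0; rewrite pos_p => /(shift_inj_dir l0 t0) ed; apply: de.
have tE : t = q * l.
  have := od_shrink pos_ortho pv vc.
  by rewrite pos_c pos_p !edist_shift ?ltW.
rewrite -[RHS in pos c = RHS]/(shift _ _ _) tE in pos_c.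
exists c => //; split => //; first exact: mulr_gt0.
by rewrite pos_c shift_opposite.
Qed.

Lemma ply_radius_ge (p v : ternary_vertex k) (l : R) (d : direction) :
  parent_edge p v l d -> l / 2 <= ply_radius pos v.
Proof.
case=> pv l0 pos_p; rewrite ler_pM2r ?invr_gt0 //.
have {1}<- : edist (pos v) (pos p) = l by rewrite pos_p edist_shift ?ltW.
by apply: (le_bigmax_cond _ (fun u => edist (pos v) (pos u)));
  rewrite /adjacent pv orbT.
Qed.

(** Turns disk membership into a polynomial inequality, using only the share of the parent edge in
    the radius. *)
Lemma in_ply_disk_of_sqr (p v u : ternary_vertex k) (l : R) (d : direction) :
  parent_edge p v l d ->
  ((pos v).1 - (pos u).1) ^+ 2 + ((pos v).2 - (pos u).2) ^+ 2 < (l / 2) ^+ 2 ->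
  in_ply_disk pos v (pos u).
Proof.
move=> e h; apply: lt_le_trans (ply_radius_ge e).
by apply: edist_lt => //; case: e => _ l0 _; rewrite divr_gt0.
Qed.

End OrthogonalDrawing.

(** * Polynomial inequalities in the shrink factor *)

Lemma sqr_spiral_lt (R : realType) (q : R) : 1 / 2 <= q -> q <= 3 / 4 ->
  (q - q ^+ 3 - q ^+ 4) ^+ 2 + (q ^+ 2 - q ^+ 5) ^+ 2 < (1 / 2) ^+ 2.
Proof.
move=> h1 h2.
have q2 : q ^+ 2 <= 9 / 16 by nra.
have q3 : q ^+ 3 <= 27 / 64 by rewrite exprS; nra.
have q3_ge0 : 0 <= q ^+ 3 by rewrite exprn_ge0 //; lra.
have x0 : 0 <= q - q ^+ 3 - q ^+ 4.
  (* The second factor is at least [1 - 36/64 - 27/64 = 1/64]. *)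
  have -> : q - q ^+ 3 - q ^+ 4 = q * (1 - q ^+ 2 - q ^+ 3) by ring.
  by rewrite mulr_ge0 //; lra.
have x1 : q - q ^+ 3 - q ^+ 4 <= 7 / 20.
  (* Expansion at [1/2]: the value there is [5/16], and every further term lowers it. *)
  pose u := q - 1 / 2; have u0 : 0 <= u by rewrite /u; lra.
  have -> : q - q ^+ 3 - q ^+ 4 =
      5 / 16 - (u / 4 + 3 * u ^+ 2 + 3 * u ^+ 3 + u ^+ 4) by rewrite /u; field.
  have := exprn_ge0 2 u0; have := exprn_ge0 3 u0; have := exprn_ge0 4 u0.
  by lra.
have y0 : 0 <= q ^+ 2 - q ^+ 5.
  have -> : q ^+ 2 - q ^+ 5 = q ^+ 2 * (1 - q ^+ 3) by ring.
  by rewrite mulr_ge0 ?sqr_ge0 //; lra.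
have y1 : q ^+ 2 - q ^+ 5 <= 7 / 20.
  (* Taylor expansion at 3/4, close to the maximum of the left-hand side *)
  pose h := q ^+ 3 + 3 / 2 * q ^+ 2 + 27 / 16 * q + 11 / 16.
  have -> : q ^+ 2 - q ^+ 5 =
      9 / 16 - 243 / 1024 - 21 / 256 * (q - 3 / 4) - (q - 3 / 4) ^+ 2 * h.
    by rewrite /h; field.
  have h0 : 0 <= h by rewrite /h; have := sqr_ge0 q; lra.
  by have := mulr_ge0 (sqr_ge0 (q - 3 / 4)) h0; lra.
(* The sum is at most [2 * (7/20)^2 = 0.245]. *)
by nra.
Qed.

Lemma swap_lt (R : realType) (q : R) : 3 / 4 < q -> q < 1 ->
  (q ^+ 2 - q) ^+ 2 + (q - q ^+ 2) ^+ 2 < (q ^+ 2 / 2) ^+ 2.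
Proof.
move=> h1 h2.
(* Equality holds at [q = 2 sqrt 2 / (1 + 2 sqrt 2)], about [0.739], just below [3/4]. *)
have h : 8 * (1 - q) ^+ 2 < q ^+ 2 by nra.
have -> : (q ^+ 2 / 2) ^+ 2 = q ^+ 2 * q ^+ 2 / 4 by field.
have -> : (q ^+ 2 - q) ^+ 2 + (q - q ^+ 2) ^+ 2
          = q ^+ 2 * (8 * (1 - q) ^+ 2) / 4 by field.
by rewrite ltr_pM2r ?invr_gt0 // ltr_pM2l // exprn_gt0 //; lra.
Qed.

(** * Collisions in the three ranges of the shrink factor *)

Section Collisions.
Variables (R : realType) (k : nat) (q : R) (pos : ternary_vertex k -> R * R).
Hypotheses (q_gt0 : 0 < q) (pos_ortho : orthogonal_drawing q pos).
Variables (p v : ternary_vertex k) (l : R) (e a b : direction).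
Hypotheses (pv : parent_edge pos p v l e) (ab : perpendicular a b).
Hypotheses (ae : a <> e) (be : b <> e).

Let l_gt0 : 0 < l. Proof. by case: pv. Qed.

Let size_parent_edge (u c : ternary_vertex k) m d :
  parent_edge pos u c m d -> size c = (size u).+1.
Proof. by case=> /is_child_size. Qed.

Lemma in_ply_disk_child : (size v < k)%N -> q < 1 / 2 ->
  exists2 u, u <> v & in_ply_disk pos v (pos u).
Proof.
move=> vk hq.
have [c pos_c vc] := child_in_direction q_gt0 pos_ortho pv vk ae.
exists c; first by move=> cv; have := size_parent_edge vc; rewrite cv => /n_Sn.
rewrite /in_ply_disk pos_c edist_shift; last by rewrite ltW ?mulr_gt0.
by apply: lt_le_trans (ply_radius_ge pv); rewrite mulrC ltr_pM2l //; lra.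
Qed.

Lemma in_ply_disk_spiral : (size v + 4 < k)%N -> 1 / 2 <= q -> q <= 3 / 4 ->
  exists2 u, u <> v & in_ply_disk pos v (pos u).
Proof.
move=> vk hq1 hq2.
have [ab1 ab2] := ab.
have ba : b <> opposite a by move=> h; apply: ab2; rewrite h; case: (a).
have step := child_in_direction q_gt0 pos_ortho.
(* Five steps of lengths [q l, ..., q^5 l]; each must avoid the direction back to the previous
   vertex. *)
have [||c1 p1 e1] := step _ _ _ _ a pv; [by lia | by [] |].
have s1 := size_parent_edge e1.
have [||c2 p2 e2] := step _ _ _ _ b e1; [by lia | by [] |].
have s2 := size_parent_edge e2.
have [||c3 p3 e3] := step _ _ _ _ (opposite a) e2; first by lia.
  by move=> h; apply: ab1; move: h; case: (a); case: (b).
have s3 := size_parent_edge e3.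
have [||c4 p4 e4] := step _ _ _ _ (opposite a) e3; first by lia.
  by case: (a).
have s4 := size_parent_edge e4.
have [||c5 p5 e5] := step _ _ _ _ (opposite b) e4; first by lia.
  by move=> h; apply: ba; move: h; case: (a); case: (b).
have s5 := size_parent_edge e5.
exists c5; first by move=> c5v; rewrite c5v in s5; lia.
apply: (in_ply_disk_of_sqr pv).
(* Steps 1, 3, 4 run along [a], steps 2 and 5 along [b]. *)
have -> : pos c5 = shift (shift (pos v) (l * (q - q ^+ 3 - q ^+ 4)) a)
                         (l * (q ^+ 2 - q ^+ 5)) b.
  by rewrite p5 p4 p3 p2 p1 !shiftN /shift /=; congr pair; ring.
rewrite sqr_offset_perpendicular // !exprMn -mulrDr.
rewrite -[2^-1]mul1r ltr_pM2l ?exprn_gt0 //.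
exact: sqr_spiral_lt.
Qed.

Lemma in_ply_disk_swap : (size v + 1 < k)%N -> 3 / 4 < q -> q < 1 ->
  exists w u, u <> w /\ in_ply_disk pos w (pos u).
Proof.
move=> vk hq1 hq2.
have [ab1 ab2] := ab.
have ba : b <> opposite a by move=> h; apply: ab2; rewrite h; case: (a).
have step := child_in_direction q_gt0 pos_ortho.
have [||c p_c vc] := step _ _ _ _ a pv; [by lia | by [] |].
have [||d p_d vd] := step _ _ _ _ b pv; [by lia | by [] |].
have sc := size_parent_edge vc; have sd := size_parent_edge vd.
have [||w p_w cw] := step _ _ _ _ b vc; [by lia | by [] |].
have [||u p_u du] := step _ _ _ _ a vd; [by lia | by [] |].
exists w, u; split.
  (* If [u = w], their parents [c] and [d] coincide, which forces [a = b]. *)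
  move=> uw; apply: ab1; case: cw du => cw _ _ [].
  rewrite uw => /(is_child_inj cw) cd _ _; move: p_d; rewrite -cd p_c.
  by apply: shift_inj_dir; rewrite mulr_gt0.
apply: (in_ply_disk_of_sqr cw).
have -> : pos u = shift (shift (pos w) (l * (q ^+ 2 - q)) a)
                        (l * (q - q ^+ 2)) b.
  by rewrite p_u p_w p_c p_d /shift /=; congr pair; ring.
rewrite sqr_offset_perpendicular //.
have -> : q * (q * l) / 2 = l * (q ^+ 2 / 2) by field.
by rewrite !(exprMn 2 l) -mulrDr ltr_pM2l ?exprn_gt0 //; apply: swap_lt.
Qed.

End Collisions.

Theorem theorem8 (R : realType) (q : R) (hq0 : 0 < q) (hq1 : q < 1) :
  exists k : nat, forall pos : ternary_vertex k -> R * R,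
    orthogonal_drawing q pos -> ~ empty_ply pos.
Proof.
(* The spiral ends five levels below [v], which has depth 1. *)
exists 6%N => pos ortho empty.
pose p : ternary_vertex 6 := [bseq].
pose v : ternary_vertex 6 := [bseq ord0].
have pv : is_child p v by apply/existsP; exists ord0.
have [l [e lpv]] := exists_parent_edge ortho pv.
have [a [b [ab ae be]]] := perpendicular_avoiding e.
have [hq|hq] := ltP q (1 / 2).
  have [//|u uv] := in_ply_disk_child hq0 ortho lpv ae _ hq.
  exact: empty.
have [hq'|hq'] := leP q (3 / 4).
  have [//|u uv] := in_ply_disk_spiral hq0 ortho lpv ab ae _ hq hq'.
  exact: empty.
have [//|w [u [uw]]] := in_ply_disk_swap hq0 ortho lpv ab ae be _ hq' hq1.
exact: empty.
Qed.
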